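(* Let $G$ be an infinite amenable group generated by a finite set $S$, and let $\alpha\in[0,1]\setminus\mathbb Q$. Then the subshift $X_\alpha\subset\{0,1\}^G$ (defined in the context) is weakly aperiodic.
   Context: $\{0,1\}^G$ carries the product topology and the shift action $(\sigma_g(x))_h=x_{g^{-1}h}$. A $G$-subshift is a closed, shift-invariant subset. It is weakly aperiodic if for each of its configurations $x$, the orbit $\{\sigma_g(x)\mid g\in G\}$ is infinite. A pattern with finite support $F\subset G$ is an element $P\in\{0,1\}^F$; it appears in $x$ if there is $g\in G$ with $x_{gh}=P_h$ for all $h\in F$. For non-empty $F$, $\operatorname{dens}(1,P)=\frac{|\{g\in F\mid P_g=1\}|}{|F|}$. Let $d$ be the graph distance on the undirected right Cayley graph with vertex set $G$ and edges $\{g,gs\}$ ($g\in G,s\in S$), $B(g,n)=\{h\in G\mid d(g,h)\le n\}$, and $K_n=B(1_G,5^n)$. For finite $F,K\subset G$ let $\mathrm{Int}(F,K)=\{g\in F\mid\forall k\in K,\ gk\in F\}$ and $\partial_KF=F\setminus\mathrm{Int}(F,K)$. The subshift $X_\alpha$ is the set of $x\in\{0,1\}^G$ in which no pattern of $\mathcal F$ appears, where a pattern $P\in\{0,1\}^F$ ($F\subset G$ finite) belongs to $\mathcal F$ if and only if the following condition fails: for every integer $n\ge1$, $$2n|\partial_{K_n}F|<|F|\ \Longrightarrow\ |\operatorname{dens}(1,P)-\alpha|\le\frac1n.$$ *)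

(* Defs.v *)
From HB Require Import structures.
From mathcomp Require Import all_boot all_order all_algebra.
From mathcomp Require Import finmap.
From mathcomp Require Import all_classical all_reals all_analysis.

Set Implicit Arguments.
Unset Strict Implicit.
Unset Printing Implicit Defensive.

Import Order.TTheory GRing.Theory Num.Theory.
Import numFieldNormedType.Exports.

Local Open Scope classical_set_scope.
Local Open Scope ring_scope.

(* Multiplicative groups are MathComp's [groupType]; their operations live in
   the scope %g. Classically every type is a choiceType, so this is no
   restriction on the group. *)

Definition generated_by (G : groupType) (S : {fset G}) : Prop :=
  forall H : {pred G}, group_closed H -> {subset S <= H} -> forall g, g \in H.

(* von Neumann's definition: a left-invariant finitely additive probability
   measure defined on all subsets of G. *)
Definition amenable (R : realType) (G : groupType) : Prop :=
  exists mu : set G -> R,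
    [/\ forall A, 0 <= mu A,
        mu [set: G] = 1,
        forall A B, A `&` B = set0 -> mu (A `|` B) = mu A + mu B
      & forall (g : G) A, mu [set (g * a)%g | a in A] = mu A].

Notation config G := (prod_topology (fun _ : G => bool)).

Definition shift (G : groupType) (g : G) (x : config G) : config G :=
  fun h => x (g^-1 * h)%g.

Record subshift (G : groupType) := Subshift {
  subshift_set :> set (config G);
  subshift_closed : closed subshift_set;
  subshift_invariant : forall g, shift g @` subshift_set `<=` subshift_set
}.

Definition shift_orbit (G : groupType) (x : config G) : set (config G) :=
  [set shift g x | g in [set: G]].

Definition weakly_aperiodic (G : groupType) (X : subshift G) : Prop :=
  forall x, subshift_set X x -> infinite_set (shift_orbit x).

Record pattern (G : groupType) := Pattern {
  supp : {fset G};
  pval :> {ffun supp -> bool}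
}.

Definition appears (G : groupType) (P : pattern G) (x : config G) : Prop :=
  exists g : G, forall h : supp P, x (g * val h)%g = P h.

Definition avoiding (G : groupType) (Fb : set (pattern G)) : set (config G) :=
  [set x | forall P, Fb P -> ~ appears P x].

Lemma avoiding_closed (G : groupType) (Fb : set (pattern G)) :
  closed (avoiding Fb).
Proof.
rewrite -openC openE => x /existsNP[P /not_implyP[FP /contrapT[g gP]]].
have cyl (h : supp P) : \forall y \near x, y (g * val h)%g = P h.
  have := @proj_continuous G (fun=> bool) (g * val h)%g x [set P h].
  by rewrite /proj gP; apply; exact: discrete_set1.
have {}cyl := @filter_forall _ _ _ (nbhs x) (nbhs_filter x) cyl.
apply: (@filterS _ _ (nbhs_filter x)) cyl => y yP.
by move=> /(_ P FP); apply; exists g.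
Qed.

Lemma avoiding_invariant (G : groupType) (Fb : set (pattern G)) (g : G) :
  shift g @` avoiding Fb `<=` avoiding Fb.
Proof.
move=> _ [x xA <-] P FP [k kP]; apply: (xA P FP).
by exists (g^-1 * k)%g => h; rewrite -kP /shift mulgA.
Qed.

Definition avoiding_subshift (G : groupType) (Fb : set (pattern G)) :
  subshift G := Subshift (@avoiding_closed G Fb) (@avoiding_invariant G Fb).

(* Meant for patterns with non-empty support; on the empty support the value
   is 0 / 0 = 0. *)
Definition dens1 (R : realType) (G : groupType) (P : pattern G) : R :=
  #|[pred g | P g]|%:R / #|` supp P|%:R.

Definition cayley_adj (G : groupType) (S : {fset G}) : rel G :=
  fun g h => [exists s : S, (h == g * val s)%g || (g == h * val s)%g].

Definition walk_lengths (G : groupType) (S : {fset G}) (g h : G) : set nat :=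
  [set size p | p in [set p : seq G | path (cayley_adj S) g p /\ last g p = h]].

(* The least length of a walk; the default 0 would only be returned for
   vertices in different components, and the graph is connected as soon as S
   generates G. *)
Definition cayley_dist (G : groupType) (S : {fset G}) (g h : G) : nat :=
  xget 0%N [set n | walk_lengths S g h n /\
                    forall m, walk_lengths S g h m -> (n <= m)%N].

Definition cayley_ball (G : groupType) (S : {fset G}) (g : G) (n : nat) :
  set G := [set h | (cayley_dist S g h <= n)%N].

(* The set K is finite in the intended use (a ball of the Cayley graph), but
   the two definitions make sense for any K. *)
Definition interior_of (G : groupType) (F : {fset G}) (K : set G) : {fset G} :=
  [fset g in F | `[< forall k, K k -> (g * k)%g \in F >]]%fset.

Definition boundary (G : groupType) (F : {fset G}) (K : set G) : {fset G} :=
  (F `\` interior_of F K)%fset.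

Definition density_ok (R : realType) (G : groupType) (S : {fset G}) (alpha : R)
    (P : pattern G) : Prop :=
  forall n : nat, (1 <= n)%N ->
    (2 * n * #|` boundary (supp P) (cayley_ball S 1%g (5 ^ n))|
       < #|` supp P|)%N ->
    `|dens1 R P - alpha| <= n%:R^-1.

Definition X_alpha (R : realType) (G : groupType) (S : {fset G}) (alpha : R) :
  subshift G := avoiding_subshift [set P | ~ density_ok S alpha P].

(* Main.v *)
(** Averages of a configuration [x] with finite orbit of size [m] are nearly
    rational: the level sets of [g |-> g^-1 x] are permuted transitively by right
    multiplications, so in a finite set [F] with small boundary they all have
    nearly the same size, and the density of [x] on [F] is close to [a / m],
    where [a] is the number of points of the orbit with value 1 at the identity.
    If [x] lies in [X_alpha], the density is also close to [alpha], and letting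
    the precision grow gives [alpha = a / m].

    Finite sets with small boundary come from the invariant mean by Tarski's
    argument: if there were none, Hall's theorem would give an injection of [M+1]
    copies of [G] into [M] copies which moves points by finitely many right
    translations, so that the mean would yield [M + 1 <= M]. *)

Require Import Defs.
From mathcomp Require Import all_boot all_order all_algebra.
From mathcomp Require Import finmap.
From mathcomp Require Import all_classical all_reals all_analysis.
From mathcomp Require Import zify.
Import Order.TTheory GRing.Theory Num.Theory.
Local Open Scope classical_set_scope.
Local Open Scope ring_scope.

Set Implicit Arguments.
Unset Strict Implicit.
Unset Printing Implicit Defensive.

(** * Hall's theorem for finite sets indexed by an arbitrary type *)

Definition hall_condition (I V : choiceType) (A : I -> {fset V}) : Prop :=
  forall J : {fset I}, (#|` J| <= #|` (\bigcup_(i <- J) A i)%fset|)%N.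

(** Zorn's lemma for reverse inclusion. A chain is bounded by its pointwise intersection, which
    inherits Hall's condition because, on each finite [J], it agrees with a single member of the
    chain, all sets being finite. *)
Lemma hall_condition_minimal (I V : choiceType) (A : I -> {fset V}) :
  hall_condition A ->
  exists B, [/\ hall_condition B, forall i, (B i `<=` A i)%fset
    & forall C, hall_condition C -> (forall i, (C i `<=` B i)%fset) -> C = B].
Proof.
move=> hallA.
pose T := {B : I -> {fset V} |
  hall_condition B /\ forall i, (B i `<=` A i)%fset}.
pose R (B C : T) := `[< forall i, (sval C i `<=` sval B i)%fset >].
have Rxx B : R B B by apply/asboolP => i.
have Rtr B C D : R B C -> R C D -> R B D.
  by move=> /asboolP BC /asboolP CD; apply/asboolP => i; apply: fsubset_trans.
have Ranti B C : R B C -> R C B -> B = C.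
  case: B C => [B hB] [C hC] /asboolP BC /asboolP CB.
  have eqBC : B = C by apply/funext => i; apply/eqP; rewrite eqEfsubset BC CB.
  by case: _ / eqBC hC {BC CB} => hC; rewrite (Prop_irrelevance hB hC).
suff totR ch : total_on ch R -> exists t, forall s, ch s -> R s t.
  have [[B [hallB subB]] maxB] := Zorn Rxx Rtr Ranti totR.
  exists B; split=> // C hallC CB.
  have CA i : (C i `<=` A i)%fset by apply: fsubset_trans (subB i).
  pose C' : T := exist _ C (conj hallC CA).
  by suff /maxB[] : R (exist _ B (conj hallB subB)) C' by []; apply/asboolP.
move=> totch.
pose C i := [fset v in A i | `[< forall B, ch B -> v \in sval B i >]]%fset.
have CA i : (C i `<=` A i)%fset by apply/fsubsetP => v; rewrite !inE => /andP[].
suff hallC : hall_condition C.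
  exists (exist _ C (conj hallC CA)) => B chB; apply/asboolP => i /=.
  by apply/fsubsetP => v; rewrite !inE /= => /andP[_ /asboolP]; apply.
move=> J.
have [ch0|/set0P[B0 chB0]] := eqVneq ch set0.
  rewrite (eq_bigr A) // => i _; apply/fsetP => v; rewrite !inE.
  by case: (v \in A i) => //=; apply/asboolP => B; rewrite ch0.
(* A chain member of least total size over [J] is smallest at every index of [J] simultaneously,
   hence lies inside [C] there. *)
pose w (B : T) := (\sum_(i <- J) #|` sval B i|)%N.
have exw : exists n, `[< exists2 B, ch B & w B = n >].
  by exists (w B0); apply/asboolP; exists B0.
case: (ex_minnP exw) => n /asboolP[B chB wB] minB.
have [hallB subB] := svalP B.
apply: leq_trans (hallB J) (fsubset_leq_card _).
apply/bigfcupsP => i iJ _; apply: fsubset_trans (bigfcup_sup C iJ isT).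
apply/fsubsetP => v vB; rewrite !inE (fsubsetP (subB i)) //=.
apply/asboolP => D chD.
have [/asboolP DB|/asboolP/(_ i)/fsubsetP->//] := totch B D chB chD.
have wD : (w B <= w D)%N by rewrite wB; apply: minB; apply/asboolP; exists D.
suff -> : sval D i = sval B i by [].
apply/eqP; rewrite eqEfcard DB leqNgt; apply/negP => lt_DB.
suff : (w D < w B)%N by rewrite ltnNge wD.
rewrite /w !(big_fsetD1 i iJ) /= -addSn leq_add // leq_sum // => j _.
exact: fsubset_leq_card.
Qed.

(** Deleting [x] from [A i] breaks Hall's condition by minimality. A violating index set must
    contain [i]; [J] is what remains of it without [i]. *)
Lemma hall_condition_remove (I V : choiceType) (A : I -> {fset V}) i x :
  hall_condition A ->
  (forall C, hall_condition C -> (forall i, (C i `<=` A i)%fset) -> C = A) ->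
  x \in A i ->
  exists2 J : {fset I}, i \notin J &
    (#|` (A i `\ x `|` \bigcup_(j <- J) A j)%fset| <= #|` J|)%N.
Proof.
move=> hallA minA xA.
pose C j := if j == i then (A i `\ x)%fset else A j.
have Cout (J : {fset I}) : i \notin J ->
    (\bigcup_(j <- J) C j = \bigcup_(j <- J) A j)%fset.
  move=> iJ; apply: eq_big_seq => j jJ; rewrite /C ifN //.
  by apply: contraNneq iJ => <-.
have : ~ hall_condition C.
  move=> /minA AC; have : x \in C i.
    by rewrite AC // => j; rewrite /C; case: eqVneq => // ->; rewrite fsubD1set.
  by rewrite /C eqxx !inE eqxx.
move=> /existsNP[J /negP]; rewrite -ltnNge => ltJ.
have iJ : i \in J.
  by apply: contraLR ltJ => iJ; rewrite Cout // -leqNgt hallA.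
exists (J `\ i)%fset; first by rewrite !inE eqxx.
move: ltJ; rewrite (cardfsD1 i J) iJ add1n ltnS (big_fsetD1 i iJ) /=.
by rewrite Cout ?inE ?eqxx // {1}/C eqxx.
Qed.

(* Rado's proof of Hall's theorem: in a minimal family satisfying Hall's
   condition all sets are singletons, by submodularity of the cardinality. *)
Lemma hall_marriage (I V : choiceType) (A : I -> {fset V}) :
  hall_condition A -> exists f : I -> V, injective f /\ forall i, f i \in A i.
Proof.
move=> /hall_condition_minimal[B [hallB BA minB]].
have B1 i : exists x, B i = [fset x]%fset.
  have : (0 < #|` B i|)%N.
    by have := hallB [fset i]%fset; rewrite cardfs1 big_seq_fset1.
  rewrite cardfs_gt0 => /fset0Pn[x xB]; exists x.
  apply/fsetP => y; rewrite inE; apply/idP/eqP => [yB|->//].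
  apply/eqP; apply: contraT => neq_yx.
  have [J iJ leJ] := hall_condition_remove hallB minB xB.
  have [K iK leK] := hall_condition_remove hallB minB yB.
  have := leq_add leJ leK; 
  rewrite -(cardfsUI J) -[leqLHS]cardfsUI leqNgt => /negP[].
  rewrite -addSn leq_add //.
    have iJK : i \notin (J `|` K)%fset by rewrite inE negb_or iJ.
    have := hallB (i |` (J `|` K))%fset; rewrite cardfsU1 iJK add1n => /leq_trans.
    apply; apply: fsubset_leq_card; apply/bigfcupsP => j + _.
    rewrite !inE => /or3P[/eqP->|jJ|jK]; apply/fsubsetP => z zB; rewrite !inE.
    - rewrite zB !andbT; case: (eqVneq z x) => // ->.
      by rewrite eq_sym neq_yx !orbT.
    - by rewrite (fsubsetP (bigfcup_sup B jJ isT)) // !orbT.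
    - by rewrite (fsubsetP (bigfcup_sup B jK isT)) // !orbT.
  apply: leq_trans (hallB _) (fsubset_leq_card _).
  apply/bigfcupsP => j + _; rewrite inE => /andP[jJ jK].
  apply/fsubsetP => z zB; rewrite !inE.
  by rewrite !(fsubsetP (bigfcup_sup B _ isT) z zB) // !orbT.
have [f fP] := choice B1; exists f; split=> [i j fij|i]; last first.
  by rewrite (fsubsetP (BA i)) // fP inE.
apply/eqP; apply: contraT => neq_ij.
have := hallB [fset i; j]%fset; rewrite cardfs2 neq_ij.
by rewrite big_fsetU1 ?inE //= big_seq_fset1 !fP fij fsetUid cardfs1.
Qed.

(** * Følner sets from an invariant mean *)

Lemma additive_bigU (R : realType) (T : Type) (mu : set T -> R)
    (I : eqType) (s : seq I) (A : I -> set T) :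
  (forall B C, B `&` C = set0 -> mu (B `|` C) = mu B + mu C) ->
  uniq s -> (forall i j, i != j -> A i `&` A j = set0) ->
  mu (\big[setU/set0]_(i <- s) A i) = \sum_(i <- s) mu (A i).
Proof.
move=> muU + disA; elim: s => [_|i s IHs /= /andP[is_ us]].
  by rewrite !big_nil; apply: (addrI (mu set0)); rewrite addr0 -muU ?setU0 ?setI0.
rewrite !big_cons muU ?IHs //.
rewrite big_distrr /= big1_seq // => j /= js; apply: disA.
by apply: contraNneq is_ => ->.
Qed.

Lemma mean_partition (R : realType) (T : Type) (mu : set T -> R)
    (I : finType) (A : I -> set T) :
  mu [set: T] = 1 ->
  (forall B C, B `&` C = set0 -> mu (B `|` C) = mu B + mu C) ->
  (forall i j, i != j -> A i `&` A j = set0) -> (forall x, exists i, A i x) ->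
  \sum_i mu (A i) = 1.
Proof.
move=> mu1 muU disA covA; rewrite -additive_bigU ?index_enum_uniq // -mu1.
congr mu; apply/seteqP; split=> // x _; rewrite -bigcup_seq.
by have [i Ai] := covA x; exists i => //=; apply: mem_index_enum.
Qed.

Lemma mean_packing (R : realType) (T : Type) (mu : set T -> R)
    (I : finType) (A : I -> set T) :
  (forall B, 0 <= mu B) -> mu [set: T] = 1 ->
  (forall B C, B `&` C = set0 -> mu (B `|` C) = mu B + mu C) ->
  (forall i j, i != j -> A i `&` A j = set0) -> \sum_i mu (A i) <= 1.
Proof.
move=> mu0 mu1 muU disA; rewrite -additive_bigU ?index_enum_uniq // -mu1.
set B := \big[_/_]_i _; rewrite -(setUv B) muU ?setICr //.
by rewrite lerDl.
Qed.

(** Inversion exchanges left and right translations. *)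
Lemma amenable_right (R : realType) (G : groupType) :
  amenable R G ->
  exists mu : set G -> R,
    [/\ forall A, 0 <= mu A, mu [set: G] = 1,
        forall A B, A `&` B = set0 -> mu (A `|` B) = mu A + mu B
      & forall (g : G) A, mu [set (a * g)%g | a in A] = mu A].
Proof.
move=> [mu [mu0 mu1 muU muM]].
exists (fun A => mu ((fun a => a^-1)%g @^-1` A)); split=> //.
  by move=> A B AB; rewrite preimage_setU muU // -preimage_setI AB preimage_set0.
move=> g A; rewrite -[RHS](muM (g^-1)%g); congr mu.
apply/seteqP; split=> [x [a Aa axg]|_ [a Aa <-]] /=.
  exists (g * x)%g; last by rewrite mulKg.
  by rewrite /= invgM -axg mulgK.
by exists (a^-1)%g => //; rewrite invgM invgK.
Qed.

(** Double counting of the means of the finitely many pieces [A i k j] on which [phi] sends copy [i]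
    to copy [j] by right translation by [k]: summed by source they give [M + 1], by target at most
    [M]. *)
Lemma amenable_no_bounded_injection (R : realType) (G : groupType)
    (K : {fset G}) (M : nat) (phi : G * 'I_M.+1 -> G * 'I_M) :
  amenable R G -> injective phi ->
  ~ (forall u, (u.1^-1 * (phi u).1)%g \in K).
Proof.
move=> /amenable_right[mu [mu0 mu1 muU muM]] phi_inj phiK.
pose A (i : 'I_M.+1) (k : K) (j : 'I_M) :=
  [set g | phi (g, i) = ((g * val k)%g, j)].
have rows i : \sum_(k : K) \sum_j mu (A i k j) = 1.
  rewrite pair_bigA /= (mean_partition (A := fun p : K * 'I_M => A i p.1 p.2)) //.
    move=> [k j] [k' j'] neq; apply/seteqP; split=> // g [].
    rewrite /A /= => -> [/mulgI kk' jj'].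
    by case/eqP: neq; rewrite jj' (val_inj kk').
  move=> g; have gK := phiK (g, i); exists ([` gK]%fset, (phi (g, i)).2).
  by rewrite /A /= mulVKg -surjective_pairing.
(* The translates of the pieces by their own [k] are disjoint in copy [j] since [phi] is
   injective. *)
have cols j : \sum_(i : 'I_M.+1) \sum_(k : K) mu (A i k j) <= 1.
  rewrite pair_bigA /=.
  under eq_bigr => p _ do rewrite -(muM (val p.2)).
  apply: (mean_packing (A := fun p : 'I_M.+1 * K =>
    [set (a * val p.2)%g | a in A p.1 p.2 j])) => //.
  move=> [i k] [i' k'] neq; apply/seteqP; split=> // h [[g Ag gh] [g' Ag' gh']].
  have [] : (g, i) = (g', i') by apply: phi_inj; rewrite Ag Ag' gh gh'.
  move=> gg' ii'; case/eqP: neq; congr (_, _) => //; apply: val_inj.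
  by apply: (mulgI g); rewrite gh -gh' gg'.
have : \sum_(i < M.+1) \sum_(k : K) \sum_(j < M) mu (A i k j) <= M%:R.
  under eq_bigr do rewrite exchange_big.
  rewrite exchange_big /= -[M in M%:R]card_ord -sumr_const.
  by apply: ler_sum => j _; apply: cols.
under eq_bigr do rewrite rows.
by rewrite sumr_const card_ord ler_nat ltnn.
Qed.

Lemma cardfsM (I V : choiceType) (A : {fset I}) (B : {fset V}) :
  #|` (A `*` B)%fset| = (#|` A| * #|` B|)%N.
Proof.
rewrite -(size_allpairs pair); apply/perm_size/uniq_perm.
- exact: fset_uniq.
- by apply: allpairs_uniq; rewrite ?fset_uniq // => -[? ?] [? ?].
move=> [i v]; rewrite in_fsetM /=; apply/andP/allpairsP => [[iA vB]|[p [? ? []]]].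
  by exists (i, v).
by move=> -> ->.
Qed.

(** A boundary point [g] has some [g * k] outside [F], and is recovered from the pair of [g * k] and
    [k]. *)
Lemma boundary_card_le (G : groupType) (F K : {fset G}) :
  (#|` boundary F [set` K]| <= #|` K| *
     #|` ((\bigcup_(g <- F) [fset g * k | k in K]%g) `\` F)%fset|)%N.
Proof.
set E := (_ `\` F)%fset; rewrite mulnC -cardfsM.
pose h (p : G * G) := (p.1 * p.2^-1)%g.
apply: (@leq_trans #|` [fset h p | p in (E `*` K)%fset]%fset|).
  apply: fsubset_leq_card; apply/fsubsetP => g; rewrite !inE /= => /andP[+ gF].
  rewrite gF /= => /asboolPn/existsNP[k /not_implyP[/= kK /negP gkF]].
  apply/imfsetP; exists ((g * k)%g, k); last by rewrite /h /= mulgK.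
  rewrite /= in_fsetM /= kK andbT inE gkF /=.
  by apply/bigfcupP; exists g; rewrite ?gF //; apply/imfsetP; exists k.
exact: leq_imfset_card.
Qed.

(* If every F has |F| <= N |boundary F K|, then right multiplication by
   K1 = 1 |` K enlarges F by a factor 1 + 1/M, which is Hall's condition. *)
Lemma folner (R : realType) (G : groupType) (K : {fset G}) (N : nat) :
  amenable R G ->
  exists F : {fset G}, (N * #|` boundary F [set` K]| < #|` F|)%N.
Proof.
move=> amG; apply: contrapT => /forallNP noF.
pose M := (N * #|` K|)%N; pose K1 := (1%g |` K)%fset.
pose A (u : G * 'I_M.+1) :=
  ([fset u.1 * k | k in K1]%g `*` [fset j in 'I_M])%fset.
suff /hall_marriage[phi [phi_inj phiA]] : hall_condition A.
  apply: (amenable_no_bounded_injection (K := K1) amG phi_inj) => u.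
  have := phiA u; rewrite in_fsetM => /andP[/imfsetP[k kK ->] _].
  by rewrite mulKg.
move=> J; pose F := [fset u.1 | u in J]%fset.
pose FK := (\bigcup_(g <- F) [fset g * k | k in K1]%g)%fset.
have JF : (#|` J| <= #|` F| * M.+1)%N.
  apply: (@leq_trans #|` (F `*` [fset j in 'I_M.+1])%fset|); last first.
    by rewrite cardfsM card_finset card_ord.
  apply: fsubset_leq_card.
  apply/fsubsetP => u uJ; rewrite in_fsetM !inE andbT.
  by apply/imfsetP; exists u.
have FKA : (#|` FK| * M <= #|` (\bigcup_(u <- J) A u)%fset|)%N.
  apply: (@leq_trans #|` (FK `*` [fset j in 'I_M])%fset|).
    by rewrite cardfsM card_finset card_ord.
  apply: fsubset_leq_card.
  apply/fsubsetP => -[h j]; rewrite in_fsetM /= => /andP[+ _].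
  move=> /bigfcupP[g]; rewrite andbT => /imfsetP[u uJ ->] hu.
  by apply/bigfcupP; exists u; rewrite ?uJ // in_fsetM hu /= !inE.
(* It remains to prove [|F| (M + 1) <= |FK| M]; as [F] lies in [FK], this amounts to
   [|F| <= M |FK \ F|]. *)
apply: leq_trans JF (leq_trans _ FKA).
have FFK : (F `<=` FK)%fset.
  apply/fsubsetP => g gF; apply/bigfcupP; exists g; rewrite ?gF //.
  by apply/imfsetP; exists 1%g; rewrite ?mulg1 //= !inE eqxx.
have /negP := noF F; rewrite -leqNgt => leF.
rewrite mulnS addnC -(cardfsID F FK) (fsetIidPr FFK) mulnDl leq_add2l.
apply: leq_trans leF _.
rewrite [leqRHS]mulnC /M -mulnA leq_mul2l; apply/orP; right.
apply: leq_trans (boundary_card_le F K) _; rewrite leq_mul2l; apply/orP; right.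
apply/fsubset_leq_card/fsetSD/bigfcupsP => g gF _.
apply: fsubset_trans (bigfcup_sup _ gF isT).
apply/fsubsetP => h /imfsetP[k kK ->].
by apply/imfsetP; exists k => //; rewrite /= !inE; apply/orP; right.
Qed.

(** * Balls of the Cayley graph *)

Lemma cayley_adj_sym (G : groupType) (S : {fset G}) :
  symmetric (cayley_adj S).
Proof. by move=> g h; apply: eq_existsb => s; rewrite orbC. Qed.

(** The elements [h] reachable in this sense form a subgroup containing [S]. Quantifying over every
    start [g] inside the predicate lets walks be concatenated. *)
Lemma cayley_connected (G : groupType) (S : {fset G}) :
  generated_by S ->
  forall h g, exists p, path (cayley_adj S) g p /\ last g p = (g * h)%g.
Proof.
move=> genS h.
suff : h \in [pred h | `[< forall g, exists p,
    path (cayley_adj S) g p /\ last g p = (g * h)%g >]] by move=> /asboolP.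
apply: genS => [|s sS]; last first.
  apply/asboolP => g; exists [:: (g * s)%g]; split=> //=; rewrite andbT.
  by apply/existsP; exists [` sS]%fset; rewrite eqxx.
split=> [|u v /asboolP uP /asboolP vP]; apply/asboolP => g.
  by exists [::]; rewrite mulg1.
have [p [gp lastp]] := uP g.
(* This walk leads from [g * (u / v)] to [g * u]; it is appended in reverse. *)
have [q [gq lastq]] := vP (g * (u / v))%g.
exists (p ++ rev (belast (g * (u / v))%g q)).
rewrite cat_path gp lastp last_cat lastp /=.
move: lastq; rewrite -!mulgA mulVg mulg1 => lastq; split.
  rewrite -lastq rev_path; apply: sub_path gq => x y.
  by rewrite cayley_adj_sym.
case: q lastq {gq} => [/= <-//|y q _].
by rewrite /= rev_cons last_rcons.
Qed.

(** Generation guarantees a walk, so [cayley_dist] is an attained minimum and not the default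
    [0]. *)
Lemma walk_of_cayley_ball (G : groupType) (S : {fset G}) (g h : G) (n : nat) :
  generated_by S -> cayley_ball S g n h ->
  exists p, [/\ path (cayley_adj S) g p, last g p = h & (size p <= n)%N].
Proof.
move=> genS; rewrite /cayley_ball /=.
have [p [gp lastp]] := cayley_connected genS (g^-1 * h)%g g.
rewrite mulVKg in lastp.
have exn : exists n, `[< walk_lengths S g h n >].
  by exists (size p); apply/asboolP; exists p.
have [m /asboolP mW minm] := ex_minnP exn.
have [[q [gq lastq] sizeq] _] : [set k | walk_lengths S g h k /\
    forall m, walk_lengths S g h m -> (k <= m)%N] (cayley_dist S g h).
  apply: xgetPex; exists m; split=> // k kW.
  by apply: minm; apply/asboolP.
by rewrite -sizeq; exists q.
Qed.

Lemma cayley_ball_finite (G : groupType) (S : {fset G}) (g : G) (n : nat) :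
  generated_by S -> exists E : {fset G}, cayley_ball S g n `<=` [set` E].
Proof.
move=> genS.
suff [E EP] : exists E : {fset G}, forall p,
    path (cayley_adj S) g p -> (size p <= n)%N -> last g p \in E.
  exists E => h /(walk_of_cayley_ball genS)[p [gp <- szp]] /=.
  exact: EP.
elim: n => [|n [E EP]]; first by exists [fset g]%fset => -[|//]; rewrite inE.
exists (E `|` ([fset h * s | h in E, s in S]%g
          `|` [fset h * s^-1 | h in E, s in S]%g))%fset.
move=> p; case/lastP: p => [|p h].
  by move=> _ _; rewrite inE (EP [::]).
rewrite rcons_path size_rcons ltnS last_rcons => /andP[gp ph] szp.
have lastE := EP p gp szp; rewrite !inE; apply/orP; right; apply/orP.
move: ph => /existsP[s /orP[/eqP->|/eqP ph]]; [left|right].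
  by apply/imfset2P; exists (last g p) => //; exists (val s) => //; exact: fsvalP.
apply/imfset2P; exists (last g p) => //; exists (val s).
  exact: fsvalP.
by rewrite ph mulgK.
Qed.

(** * Densities of configurations with finite orbit *)

Lemma sub_boundary (G : groupType) (F : {fset G}) (K L : set G) :
  K `<=` L -> (boundary F K `<=` boundary F L)%fset.
Proof.
move=> KL; apply: fsetDS; apply/fsubsetP => g; rewrite !inE /=.
by move=> /andP[-> /asboolP gL]; apply/asboolP => k /KL; apply: gL.
Qed.

Lemma fset_sum1_cond (T : choiceType) (F : {fset T}) (P : pred T) :
  #|` [fset f in F | P f]%fset| = (\sum_(f <- F | P f) 1)%N.
Proof. by rewrite card_fset_sum1 -big_fset_condE. Qed.

(** Right multiplication by [k] injects the interior points of colour [i] into the points of [F] of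
    colour [j]. *)
Lemma color_class_le (G : groupType) (I : finType) (c : G -> I) (i j : I)
    (k : G) (F : {fset G}) (K : set G) :
  K k -> (forall f, c f = i -> c (f * k)%g = j) ->
  (#|` [fset f in F | c f == i]%fset|
     <= #|` [fset f in F | c f == j]%fset| + #|` boundary F K|)%N.
Proof.
move=> Kk cij.
pose E := [fset (f * k^-1)%g | f in [fset f in F | c f == j]]%fset.
have cardE : #|` E| = #|` [fset f in F | c f == j]%fset|.
  by rewrite card_imfset //; apply: mulIg.
rewrite -cardE; apply: leq_trans (leq_card_fsetU _ _); apply: fsubset_leq_card.
apply/fsubsetP => f; rewrite !inE /= => /andP[fF /eqP cf].
rewrite fF /= andbT orbC.
case: asboolP => //= fK; apply/imfsetP; exists (f * k)%g; last by rewrite mulgK.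
by rewrite /= !inE /= fK //= cij.
Qed.

(** Division-free form of the statement that the density of [P]-coloured points in [F] differs from
    [|P| / |I|] by at most [|P| D / |F|]. Both bounds come from summing the pairwise inequalities
    over two sets of colours. *)
Lemma color_balanced (G : groupType) (I : finType) (c : G -> I) (P : pred I)
    (F : {fset G}) (D : nat) :
  (forall i j, #|` [fset f in F | c f == i]%fset|
     <= #|` [fset f in F | c f == j]%fset| + D)%N ->
  (#|I| * #|` [fset f in F | P (c f)]%fset| <= #|P| * (#|` F| + #|I| * D))%N /\
  (#|P| * #|` F| <= #|I| * (#|` [fset f in F | P (c f)]%fset| + #|P| * D))%N.
Proof.
pose N i := #|` [fset f in F | c f == i]%fset|.
move=> leN; have {}leN i j : (N i <= N j + D)%N by apply: leN.
have sumP (Q : pred I) :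
    (#|` [fset f in F | Q (c f)]%fset| = \sum_(i | Q i) N i)%N.
  rewrite fset_sum1_cond (partition_big c Q) //.
  apply: eq_bigr => i Qi; rewrite /N fset_sum1_cond; apply: eq_bigl => f.
  by case: (eqVneq (c f) i) => [->|]; rewrite ?Qi // andbF.
have sumF : (#|` F| = \sum_i N i)%N.
  rewrite -sumP; congr #|` _|; apply/fsetP => f.
  by rewrite !inE /= andbT.
have exch (Q Q' : pred I) :
    (#|Q'| * \sum_(i | Q i) N i <= #|Q| * (\sum_(j | Q' j) N j + #|Q'| * D))%N.
  have cst (A : pred I) n : (#|A| * n = \sum_(i | A i) n)%N.
    by rewrite sum_nat_const.
  rewrite !cst -big_split exchange_big leq_sum // => i _.
  by rewrite leq_sum.
have := (exch P predT, exch predT P); rewrite sumP sumF.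
by rewrite !(eq_card (_ : predT =i I)) // => -[].
Qed.

Lemma shift_mul (G : groupType) (g h : G) (x : config G) :
  Defs.shift (g * h)%g x = Defs.shift g (Defs.shift h x).
Proof. by apply/funext => k; rewrite /Defs.shift invgM mulgA. Qed.

(** The colour of [g] is the orbit point [g^-1 x]. The inverse makes right multiplication act on
    colours, and [x g] is the value of [g^-1 x] at the identity. *)
Lemma finite_orbit_coloring (G : groupType) (x : config G) :
  finite_set (shift_orbit x) ->
  exists (I : finType) (c : G -> I) (r : I -> G) (P : pred I),
    [/\ forall i, c (r i) = i,
        forall f f' k, c f = c f' -> c (f * k)%g = c (f' * k)%g
      & forall f, x f = P (c f)].
Proof.
move=> /finite_fsetP[X XE].
have inX g : Defs.shift g x \in X.
  have : shift_orbit x (Defs.shift g x) by exists g.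
  by rewrite XE.
pose c g : X := [` inX g^-1%g]%fset.
have /choice[r cr] (i : X) : exists g, c g = i.
  have : shift_orbit x (val i) by rewrite XE /=; apply: fsvalP.
  by move=> [g _ gi]; exists g^-1%g; apply: val_inj; rewrite /= invgK.
exists X, c, r, (fun i => (val i : config G) 1%g); split=> //.
  move=> f f' k /(congr1 val) /= ff'; apply: val_inj.
  by rewrite /= !invgM !shift_mul ff'.
by move=> f; rewrite /= /Defs.shift invgK mulg1.
Qed.

Lemma density_ok_restriction (R : realType) (G : groupType) (S : {fset G})
    (alpha : R) (x : config G) (F : {fset G}) :
  subshift_set (X_alpha S alpha) x ->
  density_ok S alpha (Pattern [ffun h : F => x (val h)]).
Proof.
move=> xX; apply: contrapT => /xX; apply.
by exists 1%g => h; rewrite mul1g ffunE.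
Qed.

Lemma dens1_restriction (R : realType) (G : groupType) (x : config G)
    (F : {fset G}) :
  dens1 R (Pattern [ffun h : F => x (val h)])
    = #|` [fset f in F | x f]%fset|%:R / #|` F|%:R.
Proof.
rewrite /dens1 /= fset_sum1_cond big_seq_fsetE /= -sum1_card.
by congr (_%:R / _); apply: eq_bigl => h; rewrite inE ffunE.
Qed.

Theorem proposition3p4 (R : realType) (G : groupType) (S : {fset G})
    (alpha : R) :
  infinite_set [set: G] -> amenable R G -> generated_by S ->
  0 <= alpha <= 1 -> irrational alpha ->
  weakly_aperiodic (X_alpha S alpha).
Proof.
move=> _ amG genS _ irr x xX /finite_orbit_coloring[I [c [r [P [cr cM xP]]]]].
pose m := #|I|; pose q : R := #|P|%:R / m%:R.
have m_gt0 : (0 < m)%N by apply/card_gt0P; exists (c 1%g).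
(* Right multiplication by [(r i)^-1 * r j] turns colour [i] into colour [j]. *)
pose K0 := [fset (r i)^-1 * r j | i in I, j in I]%g%fset.
have near_q n : (0 < n)%N -> `|alpha - q| <= 2 / n%:R.
  move=> n_gt0; have [E ballE] := cayley_ball_finite 1%g (5 ^ n) genS.
  (* One set serves both estimates: [2 * n] meets the threshold in [density_ok], and the extra [m]
     keeps the colour imbalance [m * D] below [|F| / n]. *)
  have [F] := folner (E `|` K0)%fset (2 * n * m) amG.
  set D := #|` _| => ltF.
  have bal i j : (#|` [fset f in F | c f == i]%fset|
      <= #|` [fset f in F | c f == j]%fset| + D)%N.
    apply: (color_class_le (k := ((r i)^-1 * r j)%g)) => [|f cf].
      rewrite /= inE; apply/orP; right.
      by apply/imfset2P; exists i => //; exists j.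
    by rewrite (cM f (r i)) ?cr // mulVKg.
  have [le1 le2] := color_balanced P bal.
  have F_gt0 : (0 < #|` F|)%N by apply: leq_ltn_trans ltF.
  have dens_alpha := density_ok_restriction (F := F) xX n_gt0.
  have {dens_alpha} : `|dens1 R (Pattern [ffun h : F => x (val h)]) - alpha|
      <= n%:R^-1.
    apply: dens_alpha; apply: leq_ltn_trans ltF; rewrite /=.
    apply: leq_mul; first by rewrite leq_pmulr.
    apply/fsubset_leq_card/sub_boundary => k /ballE /= kE.
    by rewrite inE kE.
  rewrite dens1_restriction.
  have -> : [fset f in F | x f]%fset = [fset f in F | P (c f)]%fset.
    by apply/fsetP => f; rewrite !inE xP.
  set a := #|` _| in le1 le2 *.
  have mD : (n * (m * D) <= #|` F|)%N.
    by apply: leq_trans (ltnW ltF); rewrite mulnA !leq_mul2r leq_pmull ?orbT.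
  have pm : (#|P| <= m)%N by apply: max_card.
  have leD : (n * (#|P| * (m * D)) <= m * #|` F|)%N.
    by rewrite mulnCA; apply: leq_mul.
  have dens_q : `|a%:R / #|` F|%:R - q| <= n%:R^-1.
    have [nR mR FR] : [/\ 0 < n%:R :> R, 0 < m%:R :> R & 0 < #|` F|%:R :> R].
      by rewrite !ltr0n.
    rewrite ler_distl lerBlDr -[n%:R^-1]div1r /q !addf_div ?gt_eqF //.
    rewrite ler_pdivrMr // mulrAC ler_pdivlMr ?mulr_gt0 //.
    rewrite ler_pdivrMr // mulrAC ler_pdivlMr ?mulr_gt0 //.
    (* With denominators cleared, the lower bound on the density follows from [le2] and the upper
       one from [le1], the error being controlled by [leD]. *)
    rewrite !mul1r -!natrM -!natrD -!natrM !ler_nat; apply/andP; split.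
      apply: (@leq_trans (n * (m * (a + #|P| * D)))); first by nia.
      by nia.
    apply: (@leq_trans (n * (#|P| * (#|` F| + m * D)))); first by nia.
    by nia.
  move=> dens_alpha; rewrite mulr_natl mulr2n.
  rewrite (le_trans (ler_distD (a%:R / #|` F|%:R) _ _)) //.
  by rewrite lerD // distrC.
apply: irr; exists (#|P|%:R / m%:R) => //.
rewrite fmorph_div /= !ratr_nat; apply/eqP; rewrite eq_sym -subr_eq0 -normr_eq0.
apply: contraT => neq0; pose d := `|alpha - q|.
have d_gt0 : 0 < d by rewrite lt_def neq0 normr_ge0.
(* A positive integer [n] above [2 / d] contradicts [near_q], since then [2 / n < d]. *)
have lt_n : 2 / d < (Num.truncn (2 / d)).+1%:R by apply: truncnS_gt.
have := near_q _ (ltn0Sn (Num.truncn (2 / d))).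
by rewrite leNgt ltr_pdivrMr // mulrC -ltr_pdivrMr ?lt_n.
Qed.
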